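(* Let $n\ge1$ be an integer, let $1<p<q<\infty$, $1<s_1,s_2<p'<\infty$ and $\frac2{p'}+\frac1q=\frac1{s_1}+\frac1{s_2}$. There is a constant $C\le1$, depending only on $n,p,q,s_1,s_2$, such that for all $g_1\in L^{s_1}(\mathbb R^n)$, $g_2\in L^{s_2}(\mathbb R^n)$ and $H\in L^p(\mathbb R^n\times\mathbb R^n)$, the function $$F(x)=\int_{\mathbb R^n\times\mathbb R^n}g_1(x-y_1)\,g_2(x-y_2)\,H(y_1,y_2)\,dy_1\,dy_2,\qquad x\in\mathbb R^n,$$ satisfies $$\|F\|_{L^q(\mathbb R^n)}\le C\,\|g_1\|_{L^{s_1}(\mathbb R^n)}\|g_2\|_{L^{s_2}(\mathbb R^n)}\|H\|_{L^p(\mathbb R^n\times\mathbb R^n)}.$$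
   Context: Primes denote dual exponents: $1/p+1/p'=1$. *)

(* Defs.v *)
From HB Require Import structures.
From mathcomp Require Import all_boot all_order all_algebra.
From mathcomp Require Import all_classical all_reals all_analysis.
From mathcomp Require Import complex.

Set Implicit Arguments.
Unset Strict Implicit.
Unset Printing Implicit Defensive.
Import Order.TTheory GRing.Theory Num.Theory.
Import numFieldNormedType.Exports.
Local Open Scope classical_set_scope.
Local Open Scope ring_scope.

(* Points of R^n are n-tuples: the type n.-tuple R carries the product (Borel)
   sigma-algebra. *)

Definition tuple_sub (R : realType) (n : nat) (x y : n.-tuple R) : n.-tuple R :=
  [tuple tnth x i - tnth y i | i < n].

Section cons_measure.
Local Open Scope ereal_scope.
Context (R : realType) (n : nat).

Definition cons_pair (p : R * n.-tuple R) : n.+1.-tuple R :=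
  [tuple of p.1 :: p.2].

Lemma measurable_cons_pair : measurable_fun [set: R * n.-tuple R] cons_pair.
Proof. exact: measurable_cons. Qed.

Variable mu : {sigma_finite_measure set (n.-tuple R) -> \bar R}.

(* The product of the Lebesgue measure on R and of mu, carried to R^(n+1)
   along (a, x) |-> a :: x. *)
Definition cons_measure : set (n.+1.-tuple R) -> \bar R :=
  pushforward ((@lebesgue_measure R) \x mu) cons_pair.

Let cons_measure0 : cons_measure set0 = 0.
Proof. by rewrite /cons_measure /pushforward preimage_set0 measure0. Qed.

Let cons_measure_ge0 A : 0 <= cons_measure A.
Proof. rewrite /cons_measure /pushforward; exact: measure_ge0. Qed.

Let cons_measure_sigma_additive : semi_sigma_additive cons_measure.
Proof.
move=> F mF tF mUF; rewrite /cons_measure /pushforward preimage_bigcup.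
apply: measure_semi_sigma_additive.
- by move=> k; rewrite -[X in measurable X]setTI; exact: measurable_cons_pair.
- apply/trivIsetP => /= i j _ _ ij; rewrite -preimage_setI.
  by move/trivIsetP : tF => /(_ _ _ _ _ ij) ->//; rewrite preimage_set0.
- by rewrite -preimage_bigcup -[X in measurable X]setTI; exact: measurable_cons_pair.
Qed.

HB.instance Definition _ := isMeasure.Build _ _ _
  cons_measure cons_measure0 cons_measure_ge0 cons_measure_sigma_additive.

Lemma cons_measureX (A : set R) (B : set (n.-tuple R)) :
  measurable A -> measurable B ->
  cons_measure [set x | A (thead x) /\ B [tuple of behead x]] =
  lebesgue_measure A * mu B.
Proof.
move=> mA mB; rewrite -product_measure1E//= /cons_measure /pushforward.
congr (_ _); apply/seteqP; split => -[a x] /=; rewrite theadE;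
  (have -> : [tuple of behead (cons_pair (a, x))] = x by exact/val_inj); by [].
Qed.

Let cons_measure_sigma_finite : sigma_finite setT cons_measure.
Proof.
have /sigma_finiteP[F [TF ndF Foo]] := sigma_finiteT (@lebesgue_measure R).
have /sigma_finiteP[G [TG ndG Goo]] := sigma_finiteT mu.
exists (fun k => [set x | F k (thead x) /\ G k [tuple of behead x]]).
  apply/seteqP; split => // x _.
  have [i _ Fi] : (\bigcup_i F i) (thead x) by rewrite -TF.
  have [j _ Gj] : (\bigcup_i G i) [tuple of behead x] by rewrite -TG.
  exists (maxn i j) => //=; split.
  - by move: Fi; exact/subsetPset/ndF/leq_maxl.
  - by move: Gj; exact/subsetPset/ndG/leq_maxr.
move=> k; have [mF Fk] := Foo k; have [mG Gk] := Goo k; split.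
  have mh : measurable_fun [set: n.+1.-tuple R] (fun x => thead x).
    exact: measurable_tnth.
  rewrite (_ : [set _ | _] = (fun x : n.+1.-tuple R => thead x) @^-1` F k `&`
    (fun x : n.+1.-tuple R => [tuple of behead x]) @^-1` G k)//.
  apply: measurableI; rewrite -[X in measurable X]setTI; first exact: mh.
  exact: measurable_behead.
by rewrite cons_measureX// lte_mul_pinfty// ge0_fin_numE.
Qed.

HB.instance Definition _ := Measure_isSigmaFinite.Build _ _ _ cons_measure
  cons_measure_sigma_finite.

End cons_measure.

Fixpoint lebesgue_tuple (R : realType) (n : nat) :
    {sigma_finite_measure set (n.-tuple R) -> \bar R} :=
  match n with
  | 0 => \d_([tuple] : 0.-tuple R)
  | n'.+1 => cons_measure (lebesgue_tuple R n')
  end.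

Lemma lebesgue_tuple_box (R : realType) (n : nat) (A : 'I_n -> set R) :
  (forall i, measurable (A i)) ->
  lebesgue_tuple R n [set x | forall i, A i (tnth x i)] =
  (\prod_(i < n) lebesgue_measure (A i))%E.
Proof.
elim: n A => [|n IH] A mA.
  by rewrite big_ord0 /= diracE mem_set// => -[].
rewrite big_ord_recl -IH//= -cons_measureX//; last first.
  rewrite (_ : [set _ | _] = \bigcap_(i in [set: 'I_n])
      ((fun x : n.-tuple R => tnth x i) @^-1` A (lift ord0 i))); last first.
    by apply/seteqP; split => [x h i _|x h i]; exact: (h i).
  apply: fin_bigcap_measurable => // i _.
  by rewrite -[X in measurable X]setTI; exact: measurable_tnth.
congr (_ _); apply/seteqP; split => x /= h.
  split=> [|i]; first exact: (h ord0).
  by have := h (lift ord0 i); rewrite [in X in X -> _](tuple_eta x) tnthS.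
case: h => h0 h i; case: (unliftP ord0 i) => [j ->|->//].
by have := h j; rewrite [in X in _ -> X](tuple_eta x) tnthS.
Qed.

Section complex_valued.
Context d (T : measurableType d) (R : realType).
Variable mu : {measure set T -> \bar R}.
Implicit Types f : T -> R[i].

Definition measurable_complex f :=
  measurable_fun [set: T] (fun x => complex.Re (f x)) /\
  measurable_fun [set: T] (fun x => complex.Im (f x)).

Definition integrable_complex f :=
  mu.-integrable [set: T] (fun x => (complex.Re (f x))%:E) /\
  mu.-integrable [set: T] (fun x => (complex.Im (f x))%:E).

Definition integral_complex f : R[i] :=
  Complex (Rintegral mu [set: T] (fun x => complex.Re (f x)))
          (Rintegral mu [set: T] (fun x => complex.Im (f x))).

(* The library's order on R[i] makes `|z| a complex number; Normc.normc z is
   the real modulus. *)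
Definition Lnorm_complex (p : R) f : \bar R :=
  Lnorm mu p%:E (fun x => (Normc.normc (f x))%:E).

Definition Lp_complex (p : R) f :=
  measurable_complex f /\ (Lnorm_complex p f < +oo)%E.

End complex_valued.

Section convolution_product.
Context (R : realType) (n : nat).
Notation Rn := (n.-tuple R).

Definition lebesgue_tuple2 : {measure set (Rn * Rn) -> \bar R} :=
  (lebesgue_tuple R n \x lebesgue_tuple R n)%E.

Definition integrand (g1 g2 : Rn -> R[i]) (H : Rn * Rn -> R[i]) (x : Rn)
    (y : Rn * Rn) : R[i] :=
  g1 (tuple_sub x y.1) * g2 (tuple_sub x y.2) * H y.

Definition convolution2 (g1 g2 : Rn -> R[i]) (H : Rn * Rn -> R[i]) (x : Rn) :
    R[i] :=
  integral_complex lebesgue_tuple2 (integrand g1 g2 H x).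

End convolution_product.

(* Main.v *)
(* The constant is C = 1. With A = |g1|^s1, B = |g2|^s2, K = |H|^p, and with the
   positive exponents a = 1/p', b = 1/s1 - 1/p', c = 1/s2 - 1/p',
   e = 1/p - 1/q, whose sum is 1,
     |g1 g2 H| = (A B)^a (A K)^b (B K)^c K^e.
   Hoelder's inequality in (y1, y2) bounds |F(x)| by
     (|A|_1 |B|_1)^a |K|_1^e U(x)^b V(x)^c
   where U(x) and V(x) are the integrals of A(x - y1) K(y) and B(x - y2) K(y).
   Since (b + c) q = 1, Hoelder's inequality in x and Tonelli's theorem bound
   the integral of (U^b V^c)^q by (|A|_1 |K|_1)^(bq) (|B|_1 |K|_1)^(cq). *)
From HB Require Import structures.
Require Import Defs.
From mathcomp Require Import all_boot all_order all_algebra.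
From mathcomp Require Import all_classical all_reals all_analysis.
From mathcomp Require Import complex.
From mathcomp Require Import measurable_realfun ring lra.
Import Order.TTheory GRing.Theory Num.Theory.
Local Open Scope classical_set_scope.
Local Open Scope ring_scope.

Set Implicit Arguments.
Unset Strict Implicit.
Unset Printing Implicit Defensive.

(** * Powers of nonnegative extended reals *)

Lemma ge0_ler_poweR (R : realType) (r : R) (x y : \bar R) :
  0 <= r -> (0 <= x -> x <= y -> x `^ r <= y `^ r)%E.
Proof.
move=> r0 x0 xy; apply: gt0_ler_poweR => //; rewrite in_itv/= leey andbT//.
exact: le_trans xy.
Qed.

Section poweR_split.
Local Open Scope ereal_scope.

(** Serves twice: pointwise, to factor the integrand into the four Hoelder factors, and on the
    integrals of [A], [B] and [K], to regroup the right-hand side. Positive exponents make the law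
    x^(r+s) = x^r x^s valid also at 0 and +oo. *)
Lemma poweR_split (R : realType) (x y z : \bar R) (a b c e : R) :
  0 <= x -> 0 <= y -> 0 <= z ->
  (0 < a)%R -> (0 < b)%R -> (0 < c)%R -> (0 < e)%R ->
  x `^ (a + b) * y `^ (a + c) * z `^ (b + (c + e)) =
  (x * y) `^ a * (x * z) `^ b * ((y * z) `^ c * z `^ e).
Proof.
move=> x0 y0 z0 a0 b0 c0 e0.
have ce0 : (0 < c + e)%R by rewrite addr_gt0.
have ne (r s : R) : (0 < r)%R -> (0 < s)%R -> (r + s != 0)%R.
  by move=> r0 s0; rewrite lt0r_neq0// addr_gt0.
rewrite !poweRM// !poweRD ?add_neq0_poweRD_def ?ne//.
(* The seven factors are, in order, x^a, x^b, y^a, y^c, z^b, z^c, z^e. *)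
by rewrite (AC (2*2*(1*2)) (((1*3)*(2*5))*((4*6)*7))).
Qed.

End poweR_split.

(** * Hoelder's inequality for nonnegative extended-valued functions *)

Section hoelder_ereal.
Context d (T : measurableType d) (R : realType).
Variable mu : {measure set T -> \bar R}.
Local Open Scope ereal_scope.

Lemma measurable_fun_poweR (f : T -> \bar R) (a : R) :
  measurable_fun [set: T] f -> measurable_fun [set: T] (fun x => f x `^ a).
Proof. by move=> mf; apply: (measurableT_comp (@measurable_poweR R a) mf). Qed.

Lemma ge0_integral_eq0_ae (f : T -> \bar R) : measurable_fun [set: T] f ->
  (forall x, 0 <= f x) -> \int[mu]_x f x = 0 -> {ae mu, forall x, f x = 0}.
Proof.
move=> mf f0 If; have /(ae_eq_integral_abs mu measurableT mf) :
    \int[mu]_x `|f x| = 0 by under eq_integral do rewrite gee0_abs//.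
by apply: filterS => x; exact.
Qed.

Lemma ge0_integral_lty_ae (f : T -> \bar R) : measurable_fun [set: T] f ->
  (forall x, 0 <= f x) -> \int[mu]_x f x < +oo ->
  {ae mu, forall x, f x \is a fin_num}.
Proof.
move=> mf f0 If; have /(integrable_ae measurableT) : mu.-integrable setT f.
  by apply/integrableP; split=> //; under eq_integral do rewrite gee0_abs//.
by apply: filterS => x; exact.
Qed.

Lemma ge0_LnormE (f : T -> \bar R) (r : R) : (forall x, 0 <= f x) ->
  'N[mu]_r%:E[f] = (\int[mu]_x f x `^ r) `^ r^-1.
Proof.
by move=> f0; rewrite unlock; under eq_integral do rewrite gee0_abs//.
Qed.

(** When both integrals are nonzero and finite, f and g are finite almost everywhere, and real
    Hoelder with exponents 1/a and 1/b applies to the functions [fine f] to the a and [fine g] to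
    the b. The integrals equal to 0 or +oo are treated first. *)
Lemma ge0_hoelder (f g : T -> \bar R) (a b : R) :
  measurable_fun [set: T] f -> measurable_fun [set: T] g ->
  (forall x, 0 <= f x) -> (forall x, 0 <= g x) ->
  (0 < a)%R -> (0 < b)%R -> (a + b = 1)%R ->
  \int[mu]_x (f x `^ a * g x `^ b) <=
  (\int[mu]_x f x) `^ a * (\int[mu]_x g x) `^ b.
Proof.
move=> mf mg f0 g0 a0 b0 ab.
have an0 : a != 0%R by rewrite gt_eqF.
have bn0 : b != 0%R by rewrite gt_eqF.
have mF : measurable_fun [set: T] (fun x => f x `^ a * g x `^ b).
  by apply: emeasurable_funM; exact: measurable_fun_poweR.
have F0 x : 0 <= f x `^ a * g x `^ b by rewrite mule_ge0// poweR_ge0.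
have If0 : 0 <= \int[mu]_x f x by exact: integral_ge0.
have Ig0 : 0 <= \int[mu]_x g x by exact: integral_ge0.
(* If one integral is 0, the right-hand side is 0 even when the other is +oo, since 0 * +oo = 0; so
   the left-hand side has to vanish exactly. *)
have vanish : {ae mu, forall x, f x = 0} \/ {ae mu, forall x, g x = 0} ->
    \int[mu]_x (f x `^ a * g x `^ b) = 0.
  move=> fg0; rewrite (ae_eq_integral (cst 0)) ?integral0//.
  by case: fg0; apply: filterS => x -> _; rewrite poweR0r// ?mul0e ?mule0.
have [fz|fn0] := eqVneq (\int[mu]_x f x) 0.
  by rewrite vanish ?mule_ge0 ?poweR_ge0//; left; exact: ge0_integral_eq0_ae.
have [gz|gn0] := eqVneq (\int[mu]_x g x) 0.
  by rewrite vanish ?mule_ge0 ?poweR_ge0//; right; exact: ge0_integral_eq0_ae.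
(* Both integrals are now nonzero, so an infinite one makes the right-hand side +oo. *)
have [foo|foo] := eqVneq (\int[mu]_x f x) +oo.
  by rewrite foo poweRyr// gt0_mulye ?leey// poweR_gt0// lt0e gn0.
have [goo|goo] := eqVneq (\int[mu]_x g x) +oo.
  by rewrite goo poweRyr// gt0_muley ?leey// poweR_gt0// lt0e fn0.
have aef : {ae mu, forall x, f x \is a fin_num}.
  by apply: ge0_integral_lty_ae => //; rewrite ltey.
have aeg : {ae mu, forall x, g x \is a fin_num}.
  by apply: ge0_integral_lty_ae => //; rewrite ltey.
have fine_integral (h : T -> \bar R) c : (0 < c)%R ->
    measurable_fun [set: T] h -> (forall x, 0 <= h x) ->
    {ae mu, forall x, h x \is a fin_num} ->
    'N[mu]_(c^-1)%:E[EFin \o (fun x => fine (h x) `^ c)%R] =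
    (\int[mu]_x h x) `^ c.
  move=> c0 mh h0 hfin; rewrite unlock invrK; congr (_ `^ _).
  under eq_integral => x _.
    rewrite /= ger0_norm ?powR_ge0// -powRrM mulfV ?gt_eqF// powRr1 ?fine_ge0//.
    over.
  apply: ae_eq_integral => //.
  - by apply/measurable_EFinP; exact: measurableT_comp.
  - by apply: filterS hfin => x hx _; rewrite /= fineK.
have mfp (h : T -> \bar R) c : measurable_fun [set: T] h ->
    measurable_fun [set: T] (fun x => fine (h x) `^ c)%R.
  move=> mh; apply: (@measurableT_comp _ _ _ _ _ _ (@powR R ^~ c)) => //.
  exact: (@measurableT_comp _ _ _ _ _ _ fine).
have := hoelder mu (mfp f a mf) (mfp g b mg).
move=> /(_ a^-1 b^-1)%R; rewrite !invr_gt0 !invrK => /(_ a0 b0 ab).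
rewrite !fine_integral//; apply: le_trans; rewrite Lnorm1.
apply: ae_ge0_le_integral => //.
- apply: measurableT_comp => //; apply/measurable_EFinP.
  by apply: measurable_funM; exact: mfp.
- apply: filterS2 aef aeg => x fx gx _ /=.
  rewrite ger0_norm ?mulr_ge0 ?powR_ge0// EFinM -!poweR_EFin !fineK//.
Qed.

(** Two-function Hoelder is used three times: once inside each pair, to merge it into a single
    function carrying the sum of the two exponents, and once on the two merged functions. *)
Lemma ge0_hoelder4 (f1 f2 f3 f4 : T -> \bar R) (a1 a2 a3 a4 : R) :
  measurable_fun [set: T] f1 -> measurable_fun [set: T] f2 ->
  measurable_fun [set: T] f3 -> measurable_fun [set: T] f4 ->
  (forall x, 0 <= f1 x) -> (forall x, 0 <= f2 x) ->
  (forall x, 0 <= f3 x) -> (forall x, 0 <= f4 x) ->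
  (0 < a1)%R -> (0 < a2)%R -> (0 < a3)%R -> (0 < a4)%R ->
  (a1 + a2 + (a3 + a4) = 1)%R ->
  \int[mu]_x (f1 x `^ a1 * f2 x `^ a2 * (f3 x `^ a3 * f4 x `^ a4)) <=
  (\int[mu]_x f1 x) `^ a1 * (\int[mu]_x f2 x) `^ a2 *
  ((\int[mu]_x f3 x) `^ a3 * (\int[mu]_x f4 x) `^ a4).
Proof.
have pair (f g : T -> \bar R) (a b : R) :
    measurable_fun [set: T] f -> measurable_fun [set: T] g ->
    (forall x, 0 <= f x) -> (forall x, 0 <= g x) -> (0 < a)%R -> (0 < b)%R ->
    exists h : T -> \bar R, [/\ measurable_fun [set: T] h, forall x, 0 <= h x,
      forall x, f x `^ a * g x `^ b = h x `^ (a + b) &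
      (\int[mu]_x h x) `^ (a + b) <=
      (\int[mu]_x f x) `^ a * (\int[mu]_x g x) `^ b].
  move=> mf mg f0 g0 a0 b0; have ab0 : (0 < a + b)%R by rewrite addr_gt0.
  have abn0 : (a + b)%R != 0%R by rewrite gt_eqF.
  (* The weights are normalised to c + e = 1, so Hoelder bounds the integral of the weighted
     geometric mean f^c g^e; the power a + b then restores f^a g^b. *)
  pose c := (a / (a + b))%R; pose e := (b / (a + b))%R.
  have ca : (c * (a + b) = a)%R by rewrite divfK.
  have eb : (e * (a + b) = b)%R by rewrite divfK.
  exists (fun x => f x `^ c * g x `^ e); split.
  - by apply: emeasurable_funM; exact: measurable_fun_poweR.
  - by move=> x; rewrite mule_ge0// poweR_ge0.
  - by move=> x; rewrite poweRM ?poweR_ge0// -!poweRrM ca eb.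
  rewrite -[X in _ <= _ `^ X * _]ca -[X in _ <= _ * _ `^ X]eb.
  rewrite !poweRrM -poweRM ?poweR_ge0//.
  apply: ge0_ler_poweR; first exact: ltW.
  - by apply: integral_ge0 => x _; rewrite mule_ge0// poweR_ge0.
  - rewrite -!poweRrM; apply: ge0_hoelder; rewrite ?divr_gt0//.
    by rewrite -mulrDl mulfV.
move=> m1 m2 m3 m4 f10 f20 f30 f40 a10 a20 a30 a40 a1234.
have [h [mh h0 hE hle]] := pair _ _ _ _ m1 m2 f10 f20 a10 a20.
have [k [mk k0 kE kle]] := pair _ _ _ _ m3 m4 f30 f40 a30 a40.
under eq_integral do rewrite hE kE.
apply: (le_trans (ge0_hoelder mh mk h0 k0 _ _ a1234)); rewrite ?addr_gt0//.
by rewrite lee_pmul ?poweR_ge0.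
Qed.

End hoelder_ereal.

(** * Invariance of Lebesgue measure on R^n under reflections and translations *)

Section reflection.
Context (R : realType).

(** By uniqueness of Lebesgue measure it suffices to test the intervals ]a, b], whose preimages [c -
    b, c - a[ have the same length. *)
Lemma lebesgue_measure_reflection (c : R) (A : set R) : measurable A ->
  pushforward (@lebesgue_measure R)
    ((fun x => c - x) : measurableTypeR R -> measurableTypeR R) A =
  lebesgue_measure A.
Proof.
have mr : measurable_fun [set: measurableTypeR R]
    ((fun x => c - x) : measurableTypeR R -> measurableTypeR R).
  exact: measurable_funB.
move=> mA; apply/esym/lebesgue_measure_unique => //= _ [[a b]] _ <-.
rewrite /pushforward /=.
rewrite (_ : _ @^-1` _ = `[c - b, c - a[%classic); last first.
  apply/seteqP; split => x /=; rewrite !in_itv/= => /andP[? ?];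
    apply/andP; split; lra.
rewrite !lebesgue_measure_itv/= !lte_fin ltrD2l ltrN2 !EFinB; case: ifP => // _.
rewrite -!EFinB; congr (_%:E); ring.
Qed.

Local Open Scope ereal_scope.

Lemma ge0_integral_reflection (f : R -> \bar R) (c : R) :
  measurable_fun [set: R] f -> (forall x, 0 <= f x) ->
  \int[lebesgue_measure]_x f (c - x)%R = \int[lebesgue_measure]_x f x.
Proof.
move=> mf f0.
have mr : measurable_fun [set: measurableTypeR R]
    ((fun x => c - x)%R : measurableTypeR R -> measurableTypeR R).
  exact: measurable_funB.
transitivity (\int[pushforward lebesgue_measure
    ((fun x => c - x)%R : measurableTypeR R -> measurableTypeR R)]_x f x).
  by rewrite ge0_integral_pushforward.
by apply: eq_measure_integral => // A mA _; exact: lebesgue_measure_reflection.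
Qed.

Lemma measurable_tuple_sub n d (T : measurableType d) (f g : T -> n.-tuple R) :
  measurable_fun [set: T] f -> measurable_fun [set: T] g ->
  measurable_fun [set: T] (fun x => tuple_sub (f x) (g x)).
Proof.
move=> mf mg; apply/measurable_fun_tnthP => i.
rewrite (_ : _ \o _ = fun x => (tnth (f x) i - tnth (g x) i)%R).
  by apply: measurable_funB; move: i; apply/measurable_fun_tnthP.
by apply/funext => x /=; rewrite /tuple_sub tnth_mktuple.
Qed.

(** Change of variables along [cons_pair], then Tonelli. It peels off the first coordinate in the
    induction on the dimension. *)
Lemma ge0_integral_cons_measure n
    (mu : {sigma_finite_measure set (n.-tuple R) -> \bar R})
    (f : n.+1.-tuple R -> \bar R) :
  measurable_fun [set: n.+1.-tuple R] f -> (forall x, 0 <= f x) ->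
  \int[cons_measure mu]_x f x =
  \int[lebesgue_measure]_a \int[mu]_x f [tuple of a :: x].
Proof.
move=> mf f0; have mc := @measurable_cons_pair R n.
transitivity (\int[(@lebesgue_measure R \x mu)]_z (f \o @cons_pair R n) z).
  by rewrite [LHS]ge0_integral_pushforward.
apply: (@fubini_tonelli1 _ _ _ _ R (@lebesgue_measure R) mu
  (f \o @cons_pair R n)).
- by apply: (@measurableT_comp _ _ _ _ _ _ f).
- by move=> z; exact: f0.
Qed.

Lemma tuple_sub_cons n (a b : R) (x y : n.-tuple R) :
  tuple_sub [tuple of a :: x] [tuple of b :: y] =
  [tuple of (a - b)%R :: tuple_sub x y].
Proof.
apply: eq_from_tnth => i; rewrite tnth_mktuple.
by case: (unliftP ord0 i) => [j ->|->]; rewrite ?tnthS ?tnth0 ?tnth_mktuple.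
Qed.

(** Induction on n, reflecting one coordinate at a time. *)
Lemma ge0_integral_tuple_subr n (f : n.-tuple R -> \bar R) (c : n.-tuple R) :
  measurable_fun [set: n.-tuple R] f -> (forall x, 0 <= f x) ->
  \int[lebesgue_tuple R n]_x f (tuple_sub c x) = \int[lebesgue_tuple R n]_x f x.
Proof.
elim: n f c => [|n IH] f c mf f0.
  by apply: eq_integral => x _; congr f; rewrite tuple0 [RHS]tuple0.
have mfc a : measurable_fun [set: n.-tuple R] (fun x => f [tuple of a :: x]).
  by apply: measurableT_comp => //; exact: measurable_cons.
have mF : measurable_fun [set: R]
    (fun a => \int[lebesgue_tuple R n]_x f [tuple of a :: x]).
  apply: (measurable_fun_fubini_tonelli_F (fun z => f (cons_pair z))) => //.
  apply: measurableT_comp => //; exact: measurable_cons_pair.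
rewrite /= !ge0_integral_cons_measure//; last first.
  apply: measurableT_comp => //; exact: measurable_tuple_sub.
(* Reflecting the outer variable on the right makes the first coordinate [thead c - a] on both
   sides; the induction hypothesis then compares the inner integrals. *)
rewrite -[RHS](ge0_integral_reflection (thead c))//; last first.
  by move=> a; exact: integral_ge0.
apply: eq_integral => a _; rewrite [in LHS](tuple_eta c).
under eq_integral do rewrite tuple_sub_cons.
by rewrite (IH (fun x => f [tuple of (thead c - a)%R :: x])).
Qed.

(** A translation is a composite of two reflections: replacing x by c - x on the left and by 0 - x
    on the right yields the integral of f(-x) on both sides. *)
Lemma ge0_integral_tuple_subl n (f : n.-tuple R -> \bar R) (c : n.-tuple R) :
  measurable_fun [set: n.-tuple R] f -> (forall x, 0 <= f x) ->
  \int[lebesgue_tuple R n]_x f (tuple_sub x c) = \int[lebesgue_tuple R n]_x f x.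
Proof.
move=> mf f0; pose o : n.-tuple R := [tuple 0%R | i < n].
rewrite -[LHS](ge0_integral_tuple_subr c)//; last first.
  apply: measurableT_comp => //; exact: measurable_tuple_sub.
rewrite -[RHS](ge0_integral_tuple_subr o)//; apply: eq_integral => x _.
congr f; apply: eq_from_tnth => i; rewrite !tnth_mktuple; ring.
Qed.

End reflection.

(* The library's sigma-finiteness of [m1 \x m2] is not reachable by inference,
   being shadowed by the instance for subprobabilities; hence this alias. *)
Section prod_sigma_finite.
Local Open Scope ereal_scope.
Context d1 d2 (T1 : measurableType d1) (T2 : measurableType d2) (R : realType).
Variables (m1 : {sigma_finite_measure set T1 -> \bar R})
  (m2 : {sigma_finite_measure set T2 -> \bar R}).

Definition prod_sigma_finite : set (T1 * T2) -> \bar R := m1 \x m2.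

HB.instance Definition _ := Measure.on prod_sigma_finite.

Let sigma_finite_prod : sigma_finite setT prod_sigma_finite.
Proof.
have /sigma_finiteP[F [TF ndF Foo]] := sigma_finiteT m1.
have /sigma_finiteP[H [TH ndH Hoo]] := sigma_finiteT m2.
exists (fun n => F n `*` H n).
  apply/seteqP; split => // -[x y] _.
  have [i _ Fi] : (\bigcup_i F i) x by rewrite -TF.
  have [j _ Hj] : (\bigcup_i H i) y by rewrite -TH.
  exists (maxn i j) => //; split => /=.
  - by move: Fi; exact/subsetPset/ndF/leq_maxl.
  - by move: Hj; exact/subsetPset/ndH/leq_maxr.
move=> k; have [mFk Fk] := Foo k; have [mHk Hk] := Hoo k.
split; first exact: measurableX.
by rewrite [ltLHS]product_measure1E// lte_mul_pinfty// ge0_fin_numE.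
Qed.

HB.instance Definition _ :=
  Measure_isSigmaFinite.Build _ _ _ prod_sigma_finite sigma_finite_prod.

End prod_sigma_finite.

(** * The modulus of a complex number *)

Section modulus.
Context (R : rcfType).
Implicit Type z : R[i].

Lemma normcE z :
  Normc.normc z = Num.sqrt (complex.Re z ^+ 2 + complex.Im z ^+ 2).
Proof. by case: z. Qed.

Lemma normc_ge0 z : 0 <= Normc.normc z.
Proof. by rewrite normcE sqrtr_ge0. Qed.

Lemma sqr_normc z : Normc.normc z ^+ 2 = complex.Re z ^+ 2 + complex.Im z ^+ 2.
Proof. by rewrite normcE sqr_sqrtr// addr_ge0// sqr_ge0. Qed.

Lemma ler_Re_normc z : `|complex.Re z| <= Normc.normc z.
Proof. by rewrite normcE -sqrtr_sqr ler_wsqrtr// lerDl sqr_ge0. Qed.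

Lemma ler_Im_normc z : `|complex.Im z| <= Normc.normc z.
Proof. by rewrite normcE -sqrtr_sqr ler_wsqrtr// lerDr sqr_ge0. Qed.

Lemma ReM z w : complex.Re (z * w) =
  complex.Re z * complex.Re w - complex.Im z * complex.Im w.
Proof. by case: z w => [a b] []. Qed.

Lemma ImM z w : complex.Im (z * w) =
  complex.Re z * complex.Im w + complex.Im z * complex.Re w.
Proof. by case: z w => [a b] []. Qed.

(** Cauchy-Schwarz in the plane: by Lagrange's identity the two squares differ by (a d - b c)^2. *)
Lemma ler_dot_normc z w :
  complex.Re z * complex.Re w + complex.Im z * complex.Im w <=
  Normc.normc z * Normc.normc w.
Proof.
apply: le_trans (ler_norm _) _.
rewrite -(ler_pXn2r (ltn0Sn 1)) ?nnegrE ?mulr_ge0 ?normc_ge0//.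
rewrite real_normK ?num_real// exprMn !sqr_normc.
case: z w => [a b] [c d] /=; rewrite -subr_ge0.
rewrite (_ : _ - _ = (a * d - b * c) ^+ 2) ?sqr_ge0//; ring.
Qed.

End modulus.

Lemma measurable_complex_comp d1 d2 (T1 : measurableType d1)
    (T2 : measurableType d2) (R : realType) (f : T1 -> R[i]) (k : T2 -> T1) :
  measurable_complex f -> measurable_fun [set: T2] k ->
  measurable_complex (f \o k).
Proof.
move=> [rf jf] mk; split.
- exact: (@measurableT_comp _ _ _ _ _ _ (fun x => complex.Re (f x))).
- exact: (@measurableT_comp _ _ _ _ _ _ (fun x => complex.Im (f x))).
Qed.

(** * Measurability and integrals of complex-valued functions *)

Section complex_functions.
Context d (T : measurableType d) (R : realType).
Variable mu : {measure set T -> \bar R}.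
Implicit Types f g : T -> R[i].

Lemma measurable_complexM f g : measurable_complex f -> measurable_complex g ->
  measurable_complex (fun x => f x * g x).
Proof.
move=> [rf jf] [rg jg]; split.
- under eq_fun do rewrite ReM.
  by apply: measurable_funB; exact: measurable_funM.
- under eq_fun do rewrite ImM.
  by apply: measurable_funD; exact: measurable_funM.
Qed.

Lemma measurable_normc f : measurable_complex f ->
  measurable_fun [set: T] (fun x => Normc.normc (f x)).
Proof.
move=> [rf jf]; under eq_fun do rewrite normcE.
apply: (@measurableT_comp _ _ _ _ _ _ (@Num.sqrt R)).
  exact: continuous_measurable_fun (@sqrt_continuous R).
by apply: measurable_funD; exact: measurable_funX.
Qed.

Lemma integrable_normc f : measurable_complex f ->
  (\int[mu]_x (Normc.normc (f x))%:E < +oo)%E -> integrable_complex mu f.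
Proof.
move=> mf foo; have mn := measurable_normc mf; case: mf => rf jf.
have dom (u : T -> R) : measurable_fun [set: T] u ->
    (forall x, `|u x| <= Normc.normc (f x)) ->
    mu.-integrable [set: T] (EFin \o u).
  move=> mu' uf; apply/integrableP; split; first exact/measurable_EFinP.
  apply: le_lt_trans foo; apply: ge0_le_integral => //.
  - by apply: measurableT_comp => //; exact/measurable_EFinP.
  - exact/measurable_EFinP.
  - by move=> x _; rewrite lee_fin.
by split; apply: dom => // x; [exact: ler_Re_normc|exact: ler_Im_normc].
Qed.

(** Let z be the integral of f. Then |z|^2 is the integral of Re z Re f + Im z Im f, which by
    Cauchy-Schwarz is at most |z| times the integral of |f|; cancel |z| when it is nonzero. *)
Lemma le_normc_integral f : measurable_complex f ->
  ((Normc.normc (integral_complex mu f))%:E <=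
   \int[mu]_x (Normc.normc (f x))%:E)%E.
Proof.
move=> mf; have [foo|] := ltP (\int[mu]_x (Normc.normc (f x))%:E)%E +oo%E;
  last by apply: le_trans; rewrite leey.
have [If Jf] := integrable_normc mf foo.
have In : mu.-integrable [set: T] (EFin \o (fun x => Normc.normc (f x))).
  apply/integrableP; split; first exact/measurable_EFinP/measurable_normc.
  by under eq_integral => x _ do rewrite /= ger0_norm ?normc_ge0//.
set z := integral_complex mu f.
rewrite -[leRHS]fineK; last first.
  by rewrite ge0_fin_numE// integral_ge0// => x _; rewrite lee_fin normc_ge0.
rewrite lee_fin -[X in _ <= X]/(Rintegral mu setT (fun x => Normc.normc (f x))).
have [->|z0] := eqVneq (Normc.normc z) 0.
  by apply: Rintegral_ge0 => x _; exact: normc_ge0.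
have zgt0 : 0 < Normc.normc z by rewrite lt0r z0 normc_ge0.
rewrite -(ler_pM2l zgt0) -expr2 sqr_normc !expr2.
(* In each square one factor stays a constant and the other is written back as the integral of
   [Re f] or [Im f]. *)
rewrite [X in _ * X + _]
  (_ : _ = Rintegral mu setT (fun x => complex.Re (f x)))//.
rewrite [X in _ + _ * X]
  (_ : _ = Rintegral mu setT (fun x => complex.Im (f x)))//.
rewrite -!RintegralZl// -RintegralD//; last 2 first.
- exact: (integrableZl measurableT (complex.Re z) If).
- exact: (integrableZl measurableT (complex.Im z) Jf).
apply: le_Rintegral => //.
- rewrite [X in _.-integrable _ X](_ : _ =
    (fun x => (complex.Re z)%:E * (complex.Re (f x))%:E) \+
    (fun x => (complex.Im z)%:E * (complex.Im (f x))%:E))%E//.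
  by apply: integrableD => //; exact: integrableZl.
- exact: (integrableZl measurableT (Normc.normc z) In).
- by move=> x _; exact: ler_dot_normc.
Qed.

End complex_functions.

(** * Measurable dependence of an integral on a parameter *)

Section integral_parameter.
Context d d' (S : measurableType d) (T : measurableType d') (R : realType).
Variable m : {sigma_finite_measure set T -> \bar R}.

(** The real integral is [fine] of the difference of the integrals of the positive and negative
    parts, and each of these is measurable in x by Tonelli. *)
Lemma measurable_Rintegral_parameter (f : S * T -> R) :
  measurable_fun [set: S * T] f ->
  measurable_fun [set: S] (fun x => Rintegral m [set: T] (fun y => f (x, y))).
Proof.
move=> mf; apply: (@measurableT_comp _ _ _ _ _ _ fine) => //.
have pE x : (fun y => (f (x, y))%:E)^\+%E = ((EFin \o f)^\+ \o pair x)%E.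
  exact: (funepos_comp (EFin \o f)).
have nE x : (fun y => (f (x, y))%:E)^\-%E = ((EFin \o f)^\- \o pair x)%E.
  exact: (funeneg_comp (EFin \o f)).
under eq_fun do rewrite integralE pE nE.
have mfE : measurable_fun [set: S * T] (EFin \o f) by exact/measurable_EFinP.
have mpos (u : S * T -> \bar R) : measurable_fun [set: S * T] u ->
    (forall z, 0 <= u z)%E ->
    measurable_fun [set: S] (fun x => \int[m]_y u (x, y))%E.
  exact: measurable_fun_fubini_tonelli_F.
apply: emeasurable_funB.
- exact: (mpos _ (measurable_funepos mfE) (funepos_ge0 _)).
- exact: (mpos _ (measurable_funeneg mfE) (funeneg_ge0 _)).
Qed.

Lemma measurable_integral_complex_parameter (f : S * T -> R[i]) :
  measurable_complex f ->
  measurable_complex (fun x => integral_complex m (fun y => f (x, y))).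
Proof.
move=> [rf jf]; split.
- exact: (measurable_Rintegral_parameter rf).
- exact: (measurable_Rintegral_parameter jf).
Qed.

End integral_parameter.

(** * The inequality on an abstract space with an invariant subtraction *)

Section bilinear_convolution.
Context (R : realType) d (G : measurableType d).
Variable mu : {sigma_finite_measure set G -> \bar R}.
(* stands for x - y, of which only the three hypotheses below are used *)
Variable sub : G -> G -> G.
Local Open Scope ereal_scope.
Hypothesis measurable_sub : measurable_fun [set: G * G] (fun x => sub x.1 x.2).
Hypothesis integral_subr : forall (f : G -> \bar R) (c : G),
  measurable_fun [set: G] f -> (forall x, 0 <= f x) ->
  \int[mu]_x f (sub c x) = \int[mu]_x f x.
Hypothesis integral_subl : forall (f : G -> \bar R) (c : G),
  measurable_fun [set: G] f -> (forall x, 0 <= f x) ->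
  \int[mu]_x f (sub x c) = \int[mu]_x f x.
Notation mu2 := (prod_sigma_finite mu mu).

Lemma measurable_comp_sub (f : G -> \bar R) d' (T : measurableType d')
    (u v : T -> G) :
  measurable_fun [set: G] f ->
  measurable_fun [set: T] u -> measurable_fun [set: T] v ->
  measurable_fun [set: T] (fun x => f (sub (u x) (v x))).
Proof.
move=> mf mu' mv; apply: (@measurableT_comp _ _ _ _ _ _ f) => //.
apply: (@measurableT_comp _ _ _ _ _ _ (fun x => sub x.1 x.2) _
  (fun x => (u x, v x))) => //; exact: measurable_fun_pair.
Qed.

Section kernels.
Context d' (T : measurableType d').
Variable m : {sigma_finite_measure set T -> \bar R}.
Variables (f g : G -> \bar R) (k l : T -> G) (h : T -> \bar R).
Hypotheses (mf : measurable_fun [set: G] f) (f0 : forall x, 0 <= f x).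
Hypotheses (mg : measurable_fun [set: G] g) (g0 : forall x, 0 <= g x).
Hypotheses (mk : measurable_fun [set: T] k) (ml : measurable_fun [set: T] l).
Hypotheses (mh : measurable_fun [set: T] h) (h0 : forall y, 0 <= h y).

Let mhsnd : measurable_fun [set: G * T] (fun z => h z.2).
Proof. exact: (@measurableT_comp _ _ _ _ _ _ h). Qed.

Let mfsub : measurable_fun [set: G * T] (fun z => f (sub z.1 (k z.2))).
Proof.
apply: measurable_comp_sub => //.
exact: (@measurableT_comp _ _ _ _ _ _ k).
Qed.

Let mgsub : measurable_fun [set: G * T] (fun z => g (sub z.1 (l z.2))).
Proof.
apply: measurable_comp_sub => //.
exact: (@measurableT_comp _ _ _ _ _ _ l).
Qed.

Lemma measurable_translate_kernel :
  measurable_fun [set: G] (fun x => \int[m]_y (f (sub x (k y)) * h y)).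
Proof.
apply: (measurable_fun_fubini_tonelli_F
  (fun z => f (sub z.1 (k z.2)) * h z.2)).
  exact: emeasurable_funM.
by move=> z; exact: mule_ge0.
Qed.

Lemma measurable_translate_kernel2 : measurable_fun [set: G]
  (fun x => \int[m]_y (f (sub x (k y)) * g (sub x (l y)) * h y)).
Proof.
apply: (measurable_fun_fubini_tonelli_F
  (fun z => f (sub z.1 (k z.2)) * g (sub z.1 (l z.2)) * h z.2)).
  by apply: emeasurable_funM => //; exact: emeasurable_funM.
by move=> z; rewrite !mule_ge0.
Qed.

(** Tonelli moves the integral in x inside, where translation invariance removes [k y]. Taking for
    [k] either projection of G * G gives the integrals of [U] and [V] below. *)
Lemma integral_translate_kernel :
  \int[mu]_x \int[m]_y (f (sub x (k y)) * h y) =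
  \int[mu]_x f x * \int[m]_y h y.
Proof.
rewrite (fubini_tonelli (fun z => f (sub z.1 (k z.2)) * h z.2)); last 2 first.
- exact: emeasurable_funM.
- by move=> z; exact: mule_ge0.
under eq_integral => y _.
  rewrite /= ge0_integralZr//; last exact: measurable_comp_sub.
  rewrite integral_subl//.
  over.
by rewrite ge0_integralZl// integral_ge0.
Qed.

End kernels.

(** Tonelli separates y1 from y2 and reflection invariance removes x. Hence the first Hoelder factor
    below is constant in x. *)
Lemma integral_translate2 (f g : G -> \bar R) (x : G) :
  measurable_fun [set: G] f -> measurable_fun [set: G] g ->
  (forall x, 0 <= f x) -> (forall x, 0 <= g x) ->
  \int[mu2]_y (f (sub x y.1) * g (sub x y.2)) =
  \int[mu]_x f x * \int[mu]_x g x.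
Proof.
move=> mf mg f0 g0.
rewrite (@fubini_tonelli1 _ _ _ _ R mu mu
  (fun y => f (sub x y.1) * g (sub x y.2))); last 2 first.
- by apply: emeasurable_funM; exact: measurable_comp_sub.
- by move=> z; exact: mule_ge0.
rewrite /fubini_F /=.
under eq_integral => y _.
  rewrite ge0_integralZl//; last exact: measurable_comp_sub.
  rewrite integral_subr//.
  over.
rewrite ge0_integralZr//; last 2 first.
- exact: measurable_comp_sub.
- exact: integral_ge0.
by rewrite integral_subr.
Qed.

(** This is the whole estimate for nonnegative functions; the complex case follows by passing to
    moduli. *)
Lemma convolution2_Lnorm_ge0 (p p' q s1 s2 : R)
    (hp : (1 < p)%R) (hpq : (p < q)%R) (hp' : (p^-1 + p'^-1 = 1)%R)
    (hs1 : (1 < s1)%R) (hs1p' : (s1 < p')%R)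
    (hs2 : (1 < s2)%R) (hs2p' : (s2 < p')%R)
    (hexp : (2 / p' + q^-1 = s1^-1 + s2^-1)%R)
    (f g : G -> \bar R) (h : G * G -> \bar R) :
  measurable_fun [set: G] f -> measurable_fun [set: G] g ->
  measurable_fun [set: G * G] h ->
  (forall x, 0 <= f x) -> (forall x, 0 <= g x) -> (forall y, 0 <= h y) ->
  'N[mu]_q%:E[(fun x => \int[mu2]_y
     (f (sub x y.1) * g (sub x y.2) * h y))] <=
  'N[mu]_s1%:E[f] * 'N[mu]_s2%:E[g] * 'N[mu2]_p%:E[h].
Proof.
move=> mf mg mh f0 g0 h0.
have p0 : (0 < p)%R by exact: lt_trans hp.
have q0 : (0 < q)%R by exact: lt_trans hpq.
have s10 : (0 < s1)%R by exact: lt_trans hs1.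
have s20 : (0 < s2)%R by exact: lt_trans hs2.
have p'0 : (0 < p')%R by exact: lt_trans hs1p'.
pose a := (p'^-1)%R; pose b := (s1^-1 - p'^-1)%R.
pose c := (s2^-1 - p'^-1)%R; pose e := (p^-1 - q^-1)%R.
have a0 : (0 < a)%R by rewrite invr_gt0.
have b0 : (0 < b)%R by rewrite subr_gt0 ltf_pV2.
have c0 : (0 < c)%R by rewrite subr_gt0 ltf_pV2.
have e0 : (0 < e)%R by rewrite subr_gt0 ltf_pV2.
(* Each reciprocal exponent is the sum of the powers with which [A], [B] or [K] enters the four
   factors: [A] in (AB)^a (AK)^b, [B] in (AB)^a (BK)^c, [K] in (AK)^b (BK)^c K^e. The last sum
   relies on b + c = 1/q, a form of [hexp]. *)
have abE : (s1^-1 = a + b)%R by rewrite /a /b; ring.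
have acE : (s2^-1 = a + c)%R by rewrite /a /c; ring.
have bceE : (p^-1 = b + (c + e))%R by rewrite /b /c /e; move: hexp; lra.
have bcE : (b + c = q^-1)%R by rewrite /b /c; move: hexp; lra.
have abce : (a + b + (c + e) = 1)%R by rewrite -addrA -bceE /a addrC.
pose A x := f x `^ s1; pose B x := g x `^ s2; pose K y := h y `^ p.
have A0 x : 0 <= A x by exact: poweR_ge0.
have B0 x : 0 <= B x by exact: poweR_ge0.
have K0 x : 0 <= K x by exact: poweR_ge0.
have mA : measurable_fun [set: G] A by exact: measurable_fun_poweR.
have mB : measurable_fun [set: G] B by exact: measurable_fun_poweR.
have mK : measurable_fun [set: G * G] K by exact: measurable_fun_poweR.
have root (x : \bar R) (s : R) : 0 <= x -> (0 < s)%R -> x = (x `^ s) `^ s^-1.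
  by move=> x0 s0; rewrite -poweRrM mulfV ?gt_eqF// poweRe1.
pose IA := \int[mu]_x A x; pose IB := \int[mu]_x B x.
pose IK := \int[mu2]_y K y.
have IA0 : 0 <= IA by exact: integral_ge0.
have IB0 : 0 <= IB by exact: integral_ge0.
have IK0 : 0 <= IK by exact: integral_ge0.
pose U x := \int[mu2]_y (A (sub x y.1) * K y).
pose V x := \int[mu2]_y (B (sub x y.2) * K y).
have U0 x : 0 <= U x by apply: integral_ge0 => y _; exact: mule_ge0.
have V0 x : 0 <= V x by apply: integral_ge0 => y _; exact: mule_ge0.
have mU : measurable_fun [set: G] U.
  exact: (measurable_translate_kernel _ mA A0 measurable_fst mK K0).
have mV : measurable_fun [set: G] V.
  exact: (measurable_translate_kernel _ mB B0 measurable_snd mK K0).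
have IU : \int[mu]_x U x = IA * IK.
  exact: (integral_translate_kernel _ mA A0 measurable_fst mK K0).
have IV : \int[mu]_x V x = IB * IK.
  exact: (integral_translate_kernel _ mB B0 measurable_snd mK K0).
pose F x := \int[mu2]_y (f (sub x y.1) * g (sub x y.2) * h y).
have F0 x : 0 <= F x by apply: integral_ge0 => y _; rewrite !mule_ge0.
have mF : measurable_fun [set: G] F.
  exact: (measurable_translate_kernel2 _ mf f0 mg g0
    measurable_fst measurable_snd mh h0).
(* The part of the pointwise Hoelder bound that is independent of x. *)
pose k := (IA * IB) `^ a * IK `^ e.
have k0 : 0 <= k by rewrite mule_ge0// poweR_ge0.
have FUV x : F x <= k * (U x `^ b * V x `^ c).
  have -> : k * (U x `^ b * V x `^ c) =
      (IA * IB) `^ a * U x `^ b * (V x `^ c * IK `^ e).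
    by rewrite /k (AC (2*2) ((1*3)*(4*2))).
  (* [IA * IB] is turned back into an integral over y, so that the right-hand side is the product of
     four integrals produced by Hoelder. *)
  rewrite -(integral_translate2 x mA mB A0 B0).
  apply: le_trans; last apply: ge0_hoelder4 => //.
  - rewrite le_eqVlt; apply/orP; left; apply/eqP; apply: eq_integral => y _.
    rewrite [X in X * _ * _](root _ _ (f0 _) s10).
    rewrite [X in _ * X * _](root _ _ (g0 _) s20).
    rewrite [X in _ * X](root _ _ (h0 _) p0).
    rewrite abE acE bceE poweR_split//; exact: poweR_ge0.
  - by apply: emeasurable_funM; exact: measurable_comp_sub.
  - by apply: emeasurable_funM => //; exact: measurable_comp_sub.
  - by apply: emeasurable_funM => //; exact: measurable_comp_sub.
  - by move=> y; exact: mule_ge0.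
  - by move=> y; exact: mule_ge0.
  - by move=> y; exact: mule_ge0.
rewrite !ge0_LnormE// -/IA -/IB -/IK abE acE bceE poweR_split// ?poweR_ge0//.
have qn0 : q != 0%R by rewrite gt_eqF.
(* Writing the bound as a 1/q-th power reduces the claim, by monotonicity, to a bound on the
   integral of F^q. *)
have -> : (IA * IB) `^ a * (IA * IK) `^ b * ((IB * IK) `^ c * IK `^ e) =
   (k `^ q * ((IA * IK) `^ (b * q) * (IB * IK) `^ (c * q))) `^ q^-1.
  rewrite (poweRrM _ b q) (poweRrM _ c q) -!poweRM ?mule_ge0 ?poweR_ge0//.
  by rewrite -root ?mule_ge0 ?poweR_ge0// /k [RHS](AC (2*2) ((1*3)*(4*2))).
apply: ge0_ler_poweR; rewrite ?invr_ge0 ?(ltW q0)//.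
  by apply: integral_ge0 => x _; exact: poweR_ge0.
apply: (@le_trans _ _ 
  (\int[mu]_x (k `^ q * (U x `^ (b * q) * V x `^ (c * q))))).
  apply: ge0_le_integral => //.
  - by move=> x _; exact: poweR_ge0.
  - exact: measurable_fun_poweR.
  - apply: emeasurable_funM => //.
    by apply: emeasurable_funM; exact: measurable_fun_poweR.
  - move=> x _; rewrite !poweRrM -!poweRM ?mule_ge0 ?poweR_ge0//.
    by apply: ge0_ler_poweR; [exact: ltW|exact: F0|exact: FUV].
rewrite ge0_integralZl//; last 3 first.
- by apply: emeasurable_funM; exact: measurable_fun_poweR.
- by move=> x _; rewrite mule_ge0// poweR_ge0.
- exact: poweR_ge0.
(* Hoelder in x with weights b q and c q, whose sum is 1 because b + c = 1/q. *)
rewrite lee_wpmul2l ?poweR_ge0// -IU -IV.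
by apply: ge0_hoelder; rewrite ?mulr_gt0// -mulrDl bcE mulVf.
Qed.

(** Let [N x] be the integral of |Phi x|. As the modulus is multiplicative, the nonnegative estimate
    bounds the L^q norm of [N]. Its finiteness gives integrability for almost every x, and the
    modulus of the integral of [Phi x] is at most [N x], which gives the norm bound. *)
Lemma convolution2_complex_bound (p p' q s1 s2 : R)
    (hp : (1 < p)%R) (hpq : (p < q)%R) (hp' : (p^-1 + p'^-1 = 1)%R)
    (hs1 : (1 < s1)%R) (hs1p' : (s1 < p')%R)
    (hs2 : (1 < s2)%R) (hs2p' : (s2 < p')%R)
    (hexp : (2 / p' + q^-1 = s1^-1 + s2^-1)%R)
    (g1 g2 : G -> R[i]) (H : G * G -> R[i])
    (Phi := fun x y => (g1 (sub x y.1) * g2 (sub x y.2) * H y)%R) :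
  Lp_complex mu s1 g1 -> Lp_complex mu s2 g2 -> Lp_complex mu2 p H ->
  [/\ {ae mu, forall x, integrable_complex mu2 (Phi x)},
      Lp_complex mu q (fun x => integral_complex mu2 (Phi x)) &
      Lnorm_complex mu q (fun x => integral_complex mu2 (Phi x)) <=
      Lnorm_complex mu s1 g1 * Lnorm_complex mu s2 g2 * Lnorm_complex mu2 p H].
Proof.
move=> [mg1 Lg1] [mg2 Lg2] [mH LH].
have q0 : (0 < q)%R by apply: lt_trans hpq; exact: lt_trans hp.
have mPhi : measurable_complex (fun z => Phi z.1 z.2).
  have sub_k k : measurable_fun [set: G * G] k ->
      measurable_fun [set: G * (G * G)] (fun z => sub z.1 (k z.2)).
    move=> mk; apply: (@measurableT_comp _ _ _ _ _ _ (fun x => sub x.1 x.2) _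
      (fun z => (z.1, k z.2))) => //.
    apply: measurable_fun_pair => //.
    exact: (@measurableT_comp _ _ _ _ _ _ k).
  apply: measurable_complexM.
    2: exact: (measurable_complex_comp mH measurable_snd).
  apply: measurable_complexM.
  - exact: (measurable_complex_comp mg1 (sub_k fst measurable_fst)).
  - exact: (measurable_complex_comp mg2 (sub_k snd measurable_snd)).
have mPhix x : measurable_complex (Phi x) :=
  measurable_complex_comp mPhi (measurable_pair1 x).
pose N x := \int[mu2]_y (Normc.normc (Phi x y))%:E.
have N0 x : 0 <= N x.
  by apply: integral_ge0 => y _; rewrite lee_fin normc_ge0.
have mN : measurable_fun [set: G] N.
  apply: (measurable_fun_fubini_tonelli_F
    (fun z => (Normc.normc (Phi z.1 z.2))%:E)).
  - by apply/measurable_EFinP; exact: measurable_normc.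
  - by move=> z; rewrite lee_fin normc_ge0.
have LN : 'N[mu]_q%:E[N] <= Lnorm_complex mu s1 g1 * Lnorm_complex mu s2 g2 *
    Lnorm_complex mu2 p H.
  apply: le_trans; last first.
    apply: (convolution2_Lnorm_ge0 hp hpq hp' hs1 hs1p' hs2 hs2p' hexp) => //;
      try (by move=> ?; rewrite lee_fin normc_ge0);
      by apply/measurable_EFinP; exact: measurable_normc.
  rewrite le_eqVlt; apply/orP; left; apply/eqP; apply: eq_Lnorm => x.
  by apply: eq_integral => y _; rewrite !Normc.normcM !EFinM.
have LNoo : 'N[mu]_q%:E[N] < +oo.
  have fin d0 (T : measurableType d0) (m : {measure set T -> \bar R}) r u :
      'N[m]_r[u] < +oo -> 'N[m]_r[u] \is a fin_num.
    by rewrite ge0_fin_numE ?Lnorm_ge0.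
  apply: (le_lt_trans LN).
  by rewrite !lte_mul_pinfty ?fin_numM ?fin ?mule_ge0 ?Lnorm_ge0.
have mF : measurable_complex (fun x => integral_complex mu2 (Phi x)).
  exact: (measurable_integral_complex_parameter mu2 mPhi).
have Fle : Lnorm_complex mu q (fun x => integral_complex mu2 (Phi x)) <=
    'N[mu]_q%:E[N].
  rewrite /Lnorm_complex !ge0_LnormE//; last first.
    by move=> x; rewrite lee_fin normc_ge0.
  apply: ge0_ler_poweR; first by rewrite invr_ge0 ltW.
    by apply: integral_ge0 => x _; exact: poweR_ge0.
  apply: ge0_le_integral => //.
  - by move=> x _; exact: poweR_ge0.
  - apply: measurable_fun_poweR; apply/measurable_EFinP.
    exact: measurable_normc.
  - exact: measurable_fun_poweR.
  - move=> x _; apply: ge0_ler_poweR; first exact: ltW.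
      by rewrite lee_fin normc_ge0.
    exact: le_normc_integral.
split.
(* The integral of N^q is finite, so N^q, and with it N, is finite almost everywhere. *)
- have : {ae mu, forall x, N x `^ q \is a fin_num}.
    apply: ge0_integral_lty_ae => //.
    + exact: measurable_fun_poweR.
    + by move=> x; exact: poweR_ge0.
    + move: LNoo; rewrite ge0_LnormE//; apply: lty_poweRy.
      by rewrite invr_neq0// gt_eqF.
  apply: filterS => x Nx; apply: integrable_normc; first exact: mPhix.
  apply: (@lty_poweRy _ _ q); first by rewrite gt_eqF.
  by rewrite ltey_eq Nx.
- by split => //; exact: le_lt_trans LNoo.
- exact: le_trans LN.
Qed.

End bilinear_convolution.

(** * The inequality on R^n *)

Theorem theorem3 (R : realType) (n : nat) (p p' q s1 s2 : R)
    (hn : (1 <= n)%N)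
    (hp : 1 < p) (hpq : p < q)
    (hp' : p^-1 + p'^-1 = 1)
    (hs1 : 1 < s1) (hs1p' : s1 < p') (hs2 : 1 < s2) (hs2p' : s2 < p')
    (hexp : 2 / p' + q^-1 = s1^-1 + s2^-1) :
  exists2 C : R, C <= 1 &
    forall (g1 g2 : n.-tuple R -> R[i]) (H : n.-tuple R * n.-tuple R -> R[i]),
      Lp_complex (lebesgue_tuple R n) s1 g1 ->
      Lp_complex (lebesgue_tuple R n) s2 g2 ->
      Lp_complex (lebesgue_tuple2 R n) p H ->
      [/\ {ae lebesgue_tuple R n, forall x : n.-tuple R,
            integrable_complex (lebesgue_tuple2 R n) (integrand g1 g2 H x)},
          Lp_complex (lebesgue_tuple R n) q (convolution2 g1 g2 H) &
          (Lnorm_complex (lebesgue_tuple R n) q (convolution2 g1 g2 H) <=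
           C%:E * Lnorm_complex (lebesgue_tuple R n) s1 g1
                * Lnorm_complex (lebesgue_tuple R n) s2 g2
                * Lnorm_complex (lebesgue_tuple2 R n) p H)%E].
Proof.
exists 1 => // g1 g2 H Lg1 Lg2 LH; rewrite mul1e.
have msub : measurable_fun [set: n.-tuple R * n.-tuple R]
    (fun x => tuple_sub x.1 x.2).
  by apply: measurable_tuple_sub.
have bound := @convolution2_complex_bound R _ _ (lebesgue_tuple R n)
  (@tuple_sub R n) msub (@ge0_integral_tuple_subr R n)
  (@ge0_integral_tuple_subl R n) p p' q s1 s2
  hp hpq hp' hs1 hs1p' hs2 hs2p' hexp g1 g2 H.
(* [lebesgue_tuple2] and [prod_sigma_finite] are the same product measure, and [convolution2]
   unfolds to the integral of [Phi], so the two statements agree by conversion. *)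
exact (bound Lg1 Lg2 LH).
Qed.
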